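(* For every coarse proximity space $(X,\mathcal{B},{\bf b})$, the boundary $\mathcal{U}X$ is compact and Hausdorff.
   Context: Coarse proximity spaces. A bornology $\mathcal{B}$ on a set $X$ is a family of subsets containing all singletons and closed under subsets and finite unions; its members are called bounded, other subsets unbounded. A coarse proximity on $(X,\mathcal{B})$ is a relation ${\bf b}$ on the power set of $X$ such that for all $A,B,C\subseteq X$: (1) $A{\bf b}B\Rightarrow B{\bf b}A$; (2) $A{\bf b}B\Rightarrow A,B\notin\mathcal{B}$; (3) $A\cap B\notin\mathcal{B}\Rightarrow A{\bf b}B$; (4) $(A\cup B){\bf b}C\iff A{\bf b}C$ or $B{\bf b}C$; (5) $A\bar{\bf b}B\Rightarrow\exists E\subseteq X$ with $A\bar{\bf b}E$ and $(X\setminus E)\bar{\bf b}B$ (a bar denotes negation). Then $(X,\mathcal{B},{\bf b})$ is a coarse proximity space. Proximities and clusters. A proximity on a set $X$ is a relation $\delta$ on the power set with: (1) $A\delta B\Rightarrow B\delta A$; (2) $A\delta B\Rightarrow A,B\ne\emptyset$; (3) $A\cap B\neq\emptyset\Rightarrow A\delta B$; (4) $A\delta(B\cup C)\iff A\delta B$ or $A\delta C$; (5) $A\bar\delta B\Rightarrow\exists E\subseteq X$ with $A\bar\delta E$ and $(X\setminus E)\bar\delta B$. It is separated if $\{x\}\delta\{y\}\iff x=y$. It induces the topology in which $A$ is closed iff ($A\delta\{x\}\Rightarrow x\in A$). A cluster in $(X,\delta)$ is a collection $\sigma$ of subsets of $X$ such that: $A,B\in\sigma\Rightarrow A\delta B$;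 if $A\delta B$ for all $B\in\sigma$ then $A\in\sigma$; if $A\cup B\in\sigma$ then $A\in\sigma$ or $B\in\sigma$. For $\delta$ separated, the Smirnov compactification $\mathfrak{X}$ is the set of all clusters with the proximity $\mathcal{A}\delta^*\mathcal{C}$ iff $A\delta C$ for all $A,C\subseteq X$ such that $A\in\sigma$ for all $\sigma\in\mathcal{A}$ and $C\in\sigma$ for all $\sigma\in\mathcal{C}$; it is known to be compact Hausdorff. Boundary. The discrete extension of ${\bf b}$ is the separated proximity $A\delta_{dis}B\iff A\cap B\ne\emptyset$ or $A{\bf b}B$. The boundary $\mathcal{U}X$ is the set of clusters in $(X,\delta_{dis})$ containing no bounded set, with the subspace proximity and topology inherited from the Smirnov compactification $\mathfrak{X}$ of $(X,\delta_{dis})$. *)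

(* Defs.v *)
From HB Require Import structures.
From mathcomp Require Import all_boot.
From mathcomp Require Import boolp classical_sets functions cardinality.
From mathcomp Require Import topology.

Set Implicit Arguments.
Unset Strict Implicit.
Unset Printing Implicit Defensive.

Local Open Scope classical_set_scope.

(* [B A] reads "A is bounded".  Finite unions include the empty one, so the
   empty set is bounded even when X is empty. *)
Record bornology (X : Type) := Bornology {
  bornology_set :> set X -> Prop ;
  bornology_singleton : forall x : X, bornology_set [set x] ;
  bornology_subset : forall A C : set X,
    A `<=` C -> bornology_set C -> bornology_set A ;
  bornology_finite_bigcup : forall F : set (set X), finite_set F ->
    (forall A, F A -> bornology_set A) ->
    bornology_set (\bigcup_(A in F) A) }.

Record coarse_proximity (X : Type) (B : bornology X) := CoarseProximity {
  coarse_near :> set X -> set X -> Prop ;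
  coarse_nearC : forall A C, coarse_near A C -> coarse_near C A ;
  coarse_near_unbounded : forall A C, coarse_near A C -> ~ B A /\ ~ B C ;
  coarse_nearI : forall A C, ~ B (A `&` C) -> coarse_near A C ;
  coarse_nearU : forall A C D,
    coarse_near (A `|` C) D <-> coarse_near A D \/ coarse_near C D ;
  coarse_near_strong : forall A C, ~ coarse_near A C ->
    exists E : set X, ~ coarse_near A E /\ ~ coarse_near (~` E) C }.

Record proximity (X : Type) := Proximity {
  near_set :> set X -> set X -> Prop ;
  near_setC : forall A B, near_set A B -> near_set B A ;
  near_set_neq0 : forall A B, near_set A B -> A <> set0 /\ B <> set0 ;
  near_setI : forall A B, A `&` B <> set0 -> near_set A B ;
  near_setU : forall A B C,
    near_set A (B `|` C) <-> near_set A B \/ near_set A C ;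
  near_set_strong : forall A B, ~ near_set A B ->
    exists E : set X, ~ near_set A E /\ ~ near_set (~` E) B }.

Definition separated_proximity (X : Type) (d : proximity X) : Prop :=
  forall x y : X, d [set x] [set y] <-> x = y.

(* An alias of X that carries the topology induced by d. *)
Definition proximity_space (X : Type) (d : proximity X) : Type := X.

Section ProximityTopology.
Variables (X : Type) (d : proximity X).

Lemma near_setS (A A' C C' : set X) :
  A `<=` A' -> C `<=` C' -> d A C -> d A' C'.
Proof.
move=> /setUidPr <- /setUidPr <- AC.
by apply/near_setU; left; apply/near_setC/near_setU; left; apply/near_setC.
Qed.

Definition proximity_closed (A : set X) : Prop :=
  forall x : X, d A [set x] -> A x.

HB.instance Definition _ := gen_eqMixin (proximity_space d).
HB.instance Definition _ := gen_choiceMixin (proximity_space d).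

Definition proximity_open : set (set (proximity_space d)) :=
  [set U | proximity_closed (~` U)].

Lemma proximity_openT : proximity_open setT.
Proof. by move=> x; rewrite setCT => /near_set_neq0[]. Qed.

Lemma proximity_openI : setI_closed proximity_open.
Proof.
move=> U V oU oV x; rewrite setCI => /near_setC/near_setU[] /near_setC H.
  by left; exact: oU.
by right; exact: oV.
Qed.

Lemma proximity_open_bigU (I : Type) (f : I -> set (proximity_space d)) :
  (forall i, proximity_open (f i)) -> proximity_open (\bigcup_i f i).
Proof.
move=> of_ x H [i _ fx]; apply: (of_ i x) fx; apply: near_setS H => //.
by apply: subsetC; exact: bigcup_sup.
Qed.

HB.instance Definition _ := isOpenTopological.Build (proximity_space d)
  proximity_openT proximity_openI proximity_open_bigU.

Lemma closed_proximityE (A : set (proximity_space d)) :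
  closed A <-> proximity_closed A.
Proof.
rewrite -openC; change (proximity_closed (~` ~` A) <-> proximity_closed A).
by rewrite setCK.
Qed.

End ProximityTopology.

Arguments proximity_open {X} d.

(* Not to be confused with [cluster], the cluster points of a filter. *)
Record prox_cluster (X : Type) (d : proximity X) := ProxCluster {
  cluster_mem :> set X -> Prop ;
  cluster_near : forall A B, cluster_mem A -> cluster_mem B -> d A B ;
  cluster_max : forall A,
    (forall B, cluster_mem B -> d A B) -> cluster_mem A ;
  cluster_prime : forall A B,
    cluster_mem (A `|` B) -> cluster_mem A \/ cluster_mem B }.

Section Smirnov.
Variables (X : Type) (d : proximity X).
Implicit Types (s : prox_cluster d) (P Q : set (prox_cluster d)).

Lemma cluster_sup s (A B : set X) : A `<=` B -> s A -> s B.
Proof.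
move=> AB sA; apply: cluster_max => C sC.
by apply: near_setS (cluster_near sA sC).
Qed.

Lemma cluster_setT s : s setT.
Proof.
apply: cluster_max => B sB.
by apply: near_setS (cluster_near sB sB).
Qed.

Definition smirnov_near P Q : Prop := forall A C : set X,
  (forall s, P s -> s A) -> (forall s, Q s -> s C) -> d A C.

Lemma smirnov_near_proof P Q : ~ smirnov_near P Q ->
  exists A C : set X, [/\ forall s, P s -> s A, forall s, Q s -> s C & ~ d A C].
Proof.
apply: contra_notP => H A C PA QC; apply: contrapT => AC.
by apply: H; exists A, C.
Qed.

Lemma smirnov_nearC P Q : smirnov_near P Q -> smirnov_near Q P.
Proof. by move=> PQ A C QA PC; apply/near_setC/PQ. Qed.

Lemma smirnov_near_neq0 P Q : smirnov_near P Q -> P <> set0 /\ Q <> set0.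
Proof.
move=> PQ; split=> e; rewrite e in PQ.
- have /near_set_neq0[] // : d set0 setT by apply: PQ => // s _; exact: cluster_setT.
- have /near_set_neq0[] // : d setT set0 by apply: PQ => // s _; exact: cluster_setT.
Qed.

Lemma smirnov_nearI P Q : P `&` Q <> set0 -> smirnov_near P Q.
Proof.
by move=> /eqP/set0P[s [Ps Qs]] A C /(_ s Ps) sA /(_ s Qs) sC; exact: cluster_near sA sC.
Qed.

Lemma smirnov_nearU P Q R :
  smirnov_near P (Q `|` R) <-> smirnov_near P Q \/ smirnov_near P R.
Proof.
split; last first.
  by case=> H A C PA QC; apply: H => // s Hs; apply: QC; [left|right].
move=> H; apply: contrapT => /not_orP[].
move=> /smirnov_near_proof[A1 [C1 [PA1 QC1 n1]]].
move=> /smirnov_near_proof[A2 [C2 [PA2 RC2 n2]]].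
have [E [A1E EC1]] := near_set_strong n1.
have [F [A2F FC2]] := near_set_strong n2.
have : d (~` E `&` ~` F) (C1 `|` C2).
  apply: H => [s Ps|s [Qs|Rs]].
  - have := cluster_setT s; rewrite -(setUv (E `|` F)) => /cluster_prime[].
      case/cluster_prime => sE.
        by case: A1E; exact: cluster_near (PA1 _ Ps) sE.
      by case: A2F; exact: cluster_near (PA2 _ Ps) sE.
    by rewrite setCU.
  - by apply: cluster_sup (QC1 _ Qs); left.
  - by apply: cluster_sup (RC2 _ Rs); right.
case/near_setU => K.
- by apply: EC1; apply: near_setS K => // x [].
- by apply: FC2; apply: near_setS K => // x [].
Qed.

Lemma smirnov_near_strong P Q : ~ smirnov_near P Q ->
  exists R, ~ smirnov_near P R /\ ~ smirnov_near (~` R) Q.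
Proof.
move=> /smirnov_near_proof[A [C [PA QC AC]]].
have [E [AE EC]] := near_set_strong AC.
exists [set s | s E]; split=> H.
  by apply: AE; apply: H.
apply: EC; apply: H => // s nsE.
have := cluster_setT s; rewrite -(setUv E).
by case/cluster_prime.
Qed.

Definition smirnov_proximity : proximity (prox_cluster d) :=
  Proximity smirnov_nearC smirnov_near_neq0 smirnov_nearI smirnov_nearU
            smirnov_near_strong.

Definition smirnov : topologicalType := proximity_space smirnov_proximity.

End Smirnov.

Section Boundary.
Variables (X : Type) (B : bornology X) (b : coarse_proximity B).

Lemma bornology0 : B set0.
Proof. by rewrite -(bigcup_set0 id); apply: bornology_finite_bigcup. Qed.

Lemma coarse_nearS (A A' C C' : set X) :
  A `<=` A' -> C `<=` C' -> b A C -> b A' C'.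
Proof.
move=> /setUidPr <- /setUidPr <- AC.
by apply/coarse_nearU; left; apply/coarse_nearC/coarse_nearU; left;
   apply/coarse_nearC.
Qed.

Definition discrete_near (A C : set X) : Prop := A `&` C <> set0 \/ b A C.

Lemma discrete_nearC A C : discrete_near A C -> discrete_near C A.
Proof. by case=> H; [left; rewrite setIC | right; exact: coarse_nearC]. Qed.

Lemma discrete_near_neq0 A C : discrete_near A C -> A <> set0 /\ C <> set0.
Proof.
case=> [H|/coarse_near_unbounded[nA nC]].
  by split=> e; apply: H; rewrite e ?set0I ?setI0.
by split=> e; [apply: nA|apply: nC]; rewrite e; exact: bornology0.
Qed.

Lemma discrete_nearI A C : A `&` C <> set0 -> discrete_near A C.
Proof. by left. Qed.

Lemma discrete_nearU A C D :
  discrete_near A (C `|` D) <-> discrete_near A C \/ discrete_near A D.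
Proof.
split.
- case=> [/eqP/set0P[x [Ax [Cx|Dx]]]|/coarse_nearC/coarse_nearU[]/coarse_nearC H].
  + by left; left; apply/eqP/set0P; exists x.
  + by right; left; apply/eqP/set0P; exists x.
  + by left; right.
  + by right; right.
- case=> [[/eqP/set0P[x [Ax Cx]]|H]|[/eqP/set0P[x [Ax Cx]]|H]].
  + by left; apply/eqP/set0P; exists x; split => //; left.
  + by right; apply: coarse_nearS H => // x; left.
  + by left; apply/eqP/set0P; exists x; split => //; right.
  + by right; apply: coarse_nearS H => // x; right.
Qed.

Lemma discrete_near_strong A C : ~ discrete_near A C ->
  exists E : set X, ~ discrete_near A E /\ ~ discrete_near (~` E) C.
Proof.
move=> /not_orP[/contrapT AC0 nAC].
have [E [AE EC]] := coarse_near_strong nAC.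
have AC x : A x -> C x -> False by move=> Ax Cx; have : set0 x by rewrite -AC0.
exists ((E `\` A) `|` C); split=> -[/eqP/set0P[x []]|].
- by move=> Ax [[]//|]; exact: AC.
- move=> /coarse_nearC/coarse_nearU[] /coarse_nearC // H.
  by apply: AE; apply: coarse_nearS H => // x [].
- by move=> /not_orP[].
- rewrite setCU setCD setIUl => /coarse_nearU[] H.
    by apply: EC; apply: coarse_nearS H => // x [].
  by apply: nAC; apply: coarse_nearS H => // x [].
Qed.

Definition discrete_extension : proximity X :=
  Proximity discrete_nearC discrete_near_neq0 discrete_nearI discrete_nearU
            discrete_near_strong.

Lemma discrete_extension_separated : separated_proximity discrete_extension.
Proof.
move=> x y; split=> [[/eqP/set0P[z [-> ->]] //|]|<-].
  by case/coarse_near_unbounded => /(_ (bornology_singleton B x)).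
by left; apply/eqP/set0P; exists x.
Qed.

(* As a topological space this is [set_type boundary], whose topology is the
   initial one for the inclusion; [subspace boundary] is another space, in which
   the points outside the boundary are kept and isolated. *)
Definition boundary : set (smirnov discrete_extension) :=
  [set s : prox_cluster discrete_extension | forall A, s A -> ~ B A].

End Boundary.

Arguments boundary {X B} b.

(* Main.v *)
Require Import Defs.
From mathcomp Require Import all_boot.
From mathcomp Require Import boolp classical_sets functions topology.

(** The boundary is a closed subset of the Smirnov compactification of the
    discrete extension, so everything reduces to the compactness and the
    separation of the space of clusters of an arbitrary proximity [d].

    For [A] a set of points let [clusters_through A] be the set of the clusters
    that contain [A].  These sets are closed ([closed_clusters_through]), and
    since a cluster contains [E] or its complement, those of [E] and [~` E]
    cover the space.

    Compactness ([smirnov_compact]).  Given an ultrafilter [F] of clusters, the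
    family of the [D] with [F (clusters_through D)] is prime and has pairwise
    near members.  The sets near to all members of such a family form a cluster
    ([prime_family_cluster], where the strong axiom of proximities does the
    work), and [F] converges to it.

    Separation ([smirnov_hausdorff]).  Distinct clusters contain respectively
    some [A] and [C] that are not near; the strong axiom interpolates a set [E]
    between them, and the complements of [clusters_through E] and of
    [clusters_through (~` E)] are disjoint open sets that separate the clusters.

    Closedness ([closed_boundary]).  A bounded set is never near its complement
    in the discrete extension, so a cluster omits a bounded [A] exactly when it
    contains [~` A], which is a closed condition. *)

Local Open Scope classical_set_scope.

(** * Clusters of a proximity *)

Section Clusters.
Context {X : Type} {d : proximity X}.

Lemma cluster_setVsetC (s : prox_cluster d) (E : set X) : s E \/ s (~` E).
Proof. by have := cluster_setT s; rewrite -(setUv E); exact: cluster_prime. Qed.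

Lemma prox_cluster_eq (s t : prox_cluster d) :
  cluster_mem s = cluster_mem t -> s = t.
Proof.
case: s t => s s1 s2 s3 [t t1 t2 t3] /= st; case: _ / st t1 t2 t3 => *.
by congr ProxCluster; exact: Prop_irrelevance.
Qed.

(** Clusters are maximal among pairwise near families: the one included in the
    other is equal to it.  So two distinct clusters must disagree through a pair
    of sets that are not near. *)
Lemma prox_cluster_neq_far {s t : prox_cluster d} : s <> t ->
  exists A C : set X, [/\ s A, t C & ~ d A C].
Proof.
apply: contra_notP => far; apply: prox_cluster_eq.
have near A C : s A -> t C -> d A C.
  by move=> sA tC; apply: contrapT => nAC; apply: far; exists A, C.
apply/funext => A; apply/propext; split=> HA; apply: cluster_max => C HC.
- exact: near.
- by apply: near_setC; exact: near.
Qed.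

Section PrimeFamily.
Context {T : set (set X)}.
Hypothesis T_setT : T setT.
Hypothesis T_prime : forall D E, T (D `|` E) -> T D \/ T E.
Hypothesis T_near : forall D E, T D -> T E -> d D E.

Definition near_all : set (set X) := [set A | forall D, T D -> d A D].

Let T_setVsetC (E : set X) : T E \/ T (~` E).
Proof. by apply: T_prime; rewrite setUv. Qed.

Let near_all_near (A C : set X) : near_all A -> near_all C -> d A C.
Proof.
move=> HA HC; apply: contrapT => /near_set_strong[E [AE EC]].
case: (T_setVsetC E) => [/HA//|/HC CE].
by apply: EC; exact: near_setC.
Qed.

Let near_all_max (A : set X) : (forall C, near_all C -> d A C) -> near_all A.
Proof. by move=> HA D TD; apply: HA => E TE; exact: T_near. Qed.

(** The condition [~ T (~` E)] implies [T E] and, unlike it, is stable under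
    intersections; [near_all_prime] intersects two such sets.  Here [E] comes
    from the strong axiom, applied to [A] and a member of [T] far from it. *)
Let far_member (A : set X) : ~ near_all A ->
  exists E, ~ d A E /\ ~ T (~` E).
Proof.
move=> /existsNP[D /not_implyP[TD /near_set_strong[E [AE ED]]]].
by exists E; split => // TE; apply: ED; exact: T_near.
Qed.

Let near_all_prime (A C : set X) :
  near_all (A `|` C) -> near_all A \/ near_all C.
Proof.
move=> AC; apply: contrapT => /not_orP[/far_member[E [AE nE]]].
move=> /far_member[F [CF nF]].
(* Neither complement lies in T, so by primality their union does not. *)
have TEF : T (E `&` F).
  by case: (T_setVsetC (E `&` F)) => //; rewrite setCI => /T_prime[].
have /near_setC/near_setU[/near_setC H|/near_setC H] := AC _ TEF.
- by apply: AE; apply: near_setS H => // x [].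
- by apply: CF; apply: near_setS H => // x [].
Qed.

(** A prime family of pairwise near sets extends to a cluster.  Containing the
    whole space, a prime family has [E] or [~` E] for every [E], and the strong
    axiom turns two sets that are not near into such an [E]. *)
Definition prime_family_cluster : prox_cluster d :=
  ProxCluster near_all_near near_all_max near_all_prime.

End PrimeFamily.

End Clusters.

(** * The Smirnov compactification is compact and Hausdorff *)

Section SmirnovSpace.
Context {X : Type} {d : proximity X}.

Definition clusters_through (A : set X) : set (smirnov d) :=
  [set s : prox_cluster d | s A].

(** If the cluster [s] is near [clusters_through A], then [A] is near every
    member of [s], and lies in [s] by maximality. *)
Lemma closed_clusters_through (A : set X) : closed (clusters_through A).
Proof.
apply/closed_proximityE => s As; apply: cluster_max => C sC.
by apply: As => // _ ->.
Qed.

(** The sets [clusters_through A] form a base of the closed sets: a closed set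
    is enlarged to one of them that still avoids a given outside point [s],
    because [A] is not near the member [C] of [s]. *)
Lemma open_clusters_through {U : set (smirnov d)} {s : smirnov d} :
  open U -> U s -> exists A C : set X,
    [/\ ~` U `<=` clusters_through A, clusters_through C s & ~ d A C].
Proof.
move=> oU Us.
have /smirnov_near_proof[A [C [UA sC nAC]]] :
    ~ @smirnov_near _ d (~` U) [set s].
  have /closed_proximityE cU : closed (~` U) by exact: open_closedC.
  by move=> /cU.
by exists A, C; split => //; exact: sC.
Qed.

Lemma smirnov_compact : compact [set: smirnov d].
Proof.
rewrite compact_ultra => F FU _.
pose T : set (set X) := [set D | F (clusters_through D)].
have T_setT : T setT.
  by apply: (@filterS _ F _ setT) filterT => s _; exact: cluster_setT.
have T_prime D E : T (D `|` E) -> T D \/ T E.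
  move=> FDE; case: (in_ultra_setVsetC (clusters_through D) FU) => FD.
    by left.
  right; apply: (@filterS _ F) (filterI (FDE : F _) FD) => s [].
  by move=> /cluster_prime[].
have T_near D E : T D -> T E -> d D E.
  move=> FD FE; have [s [sD sE]] := filter_ex (filterI (FD : F _) (FE : F _)).
  exact: cluster_near sD sE.
pose t : smirnov d := prime_family_cluster T_setT T_prime T_near.
exists t; split => // V; rewrite nbhsE => -[U [oU Ut] UV].
have [A [C [UA tC nAC]]] := open_clusters_through oU Ut.
case: (in_ultra_setVsetC (clusters_through A) FU) => FA.
  by case: nAC; apply: near_setC; exact: tC.
apply: filterS FA => s nsA; apply: UV; apply: contrapT => nUs.
exact/nsA/UA.
Qed.

Lemma smirnov_hausdorff : hausdorff_space (smirnov d).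
Proof.
rewrite open_hausdorff => s t /eqP st.
have [A [C [sA tC /near_set_strong[E [AE EC]]]]] := prox_cluster_neq_far st.
exists (~` clusters_through E, ~` clusters_through (~` E)) => /=.
  split; apply/mem_set.
  - by move=> sE; apply: AE; exact: cluster_near sA sE.
  - by move=> tE; apply: EC; exact: cluster_near tE tC.
split; try by apply: closed_openC; exact: closed_clusters_through.
apply/eqP; rewrite -subset0 => u [uE uCE].
by case: (cluster_setVsetC u E).
Qed.

End SmirnovSpace.

(** * Subspaces *)

Section SetType.
Context {T : topologicalType} {A : set T}.

Lemma compact_set_type : compact A -> compact [set: set_type A].
Proof.
move=> cA F FF _.
have FA : (set_val @ F) A.
  by apply: (@filterS _ F _ setT) filterT => x _; exact: set_valP.
have [p [Ap clp]] := cA _ _ FA.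
exists (SigSub (mem_set Ap)); split => // P V FP [_ [[O oO <-] Op] OV].
have FvP : (set_val @ F) (set_val @` P).
  by apply: (@filterS _ F) FP => x Px; exists x.
have [_ [[x Px <-] Ox]] := clp _ O FvP (open_nbhs_nbhs (conj oO Op)).
by exists x; split => //; exact: OV.
Qed.

Lemma hausdorff_set_type : hausdorff_space T -> hausdorff_space (set_type A).
Proof.
move=> hT x y xy; apply: val_inj; apply: hT => P Q xP yQ.
have [z [Pz Qz]] := xy _ _ (@initial_continuous _ _ (@set_val _ A) x _ xP)
                          (@initial_continuous _ _ (@set_val _ A) y _ yQ).
by exists (set_val z).
Qed.

End SetType.

(** * The boundary of a coarse proximity space *)

Section BoundaryClosed.
Context {X : Type} {B : bornology X} {b : coarse_proximity B}.

(** A bounded set is [b]-near to nothing, so it is near only to what it meets.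
    Hence no cluster contains both it and its complement. *)
Lemma bounded_far_setC {A : set X} : B A -> ~ discrete_extension b A (~` A).
Proof. by move=> BA [|/coarse_near_unbounded[]//]; rewrite setICr. Qed.

Lemma boundary_bigcap :
  boundary b = \bigcap_(A in [set A | B A]) clusters_through (~` A).
Proof.
apply/seteqP; split=> s Hs A.
- by move=> BA; case: (cluster_setVsetC s A) => [sA|//]; case: (Hs A sA).
- by move=> sA BA; case: (bounded_far_setC BA (cluster_near sA (Hs A BA))).
Qed.

Lemma closed_boundary : closed (boundary b).
Proof.
by rewrite boundary_bigcap; apply: closed_bigI => A _;
  exact: closed_clusters_through.
Qed.

End BoundaryClosed.

Theorem proposition4p5 (X : Type) (B : bornology X) (b : coarse_proximity B) :
  compact [set: set_type (boundary b)] /\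
  hausdorff_space (set_type (boundary b)).
Proof.
split; last by apply: hausdorff_set_type; exact: smirnov_hausdorff.
apply: compact_set_type.
by apply: subclosed_compact closed_boundary smirnov_compact _.
Qed.
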